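(* Let $G$ be a finite $r$-uniform hypergraph with maximum degree $\Delta$, and let $\mathcal{E}=\{E_1,\ldots,E_n\}$ be a partition of its edge set $E(G)$ with $|E_i|\ge r\Delta+1$ for all $i$. Then $\mathbf{RG}(\mathcal{M}(G),\mathcal{E})$ is connected.
   Context: The matching complex $\mathcal{M}(G)$ is the complex on ground set $E(G)$ whose simplices are the matchings (sets of pairwise disjoint edges). A full rainbow matching of $(G,\mathcal{E})$ is a matching containing exactly one edge from each $E_i$. $\mathbf{RG}(\mathcal{M}(G),\mathcal{E})$ is the graph on full rainbow matchings, two being adjacent if their union is a matching of size $n+1$. *)

(* Defs.v *)
From mathcomp Require Import all_boot.
Set Implicit Arguments. Unset Strict Implicit. Unset Printing Implicit Defensive.

(* A finite hypergraph on vertex type V : finType is given by its edge set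
   E : {set {set V}} (each edge is a set of vertices). *)

Section Hyper.
Variable V : finType.

Definition uniform (r : nat) (E : {set {set V}}) : bool :=
  [forall e in E, #|e| == r].

Definition degree (E : {set {set V}}) (v : V) : nat :=
  #|[set e in E | v \in e]|.

Definition maxdeg (E : {set {set V}}) : nat := \max_(v : V) degree E v.

(* M is a matching of G: a set of pairwise disjoint edges of G
   (i.e. a simplex of the matching complex M(G)). *)
Definition matching (E M : {set {set V}}) : bool :=
  (M \subset E) &&
  [forall e in M, forall f in M, (e != f) ==> [disjoint e & f]].

Definition edge_partition (n : nat) (E : {set {set V}})
    (part : 'I_n -> {set {set V}}) : Prop :=
  (forall i j, i != j -> [disjoint part i & part j]) /\
  \bigcup_(i < n) part i = E.

Definition full_rainbow (n : nat) (E : {set {set V}})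
    (part : 'I_n -> {set {set V}}) (M : {set {set V}}) : bool :=
  matching E M && [forall i, #|M :&: part i| == 1].

Definition RG_adj (n : nat) (E : {set {set V}})
    (part : 'I_n -> {set {set V}}) : rel {set {set V}} :=
  fun M1 M2 => [&& full_rainbow E part M1, full_rainbow E part M2,
                   matching E (M1 :|: M2) & #|M1 :|: M2| == n.+1].

Definition RG_connected (n : nat) (E : {set {set V}})
    (part : 'I_n -> {set {set V}}) : Prop :=
  forall M1 M2, full_rainbow E part M1 -> full_rainbow E part M2 ->
    connect (RG_adj E part) M1 M2.

End Hyper.

(* Main.v *)
Require Import Defs.
From HB Require Import structures.
From mathcomp Require Import all_boot all_order all_algebra.
From mathcomp Require Import lra.

(* Write X_I for the complex of matchings whose edges lie in the union F_I of
   the classes E_i, i in I.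

   Homological part. Given two full rainbow matchings M1 and M2, suppose that
   X_I has no homology (over the rationals) in degree #|I| - 1 for all nonempty
   I. Then, by induction on #|I|, there are chains z_I of X_I on simplices of
   size #|I| + 1 with
     d z_I = M2_I - M1_I - \sum_(i in I) +- z_(I \ i),
   a chain-level prism between M1 and M2. The indicator phi of the
   reconfiguration component of M1 is a cocycle: a matching of size n + 1 having
   one full rainbow facet has exactly two, with opposite signs, and these are
   adjacent. Also phi vanishes on z_I for I proper, so
   0 = phi (d z_[n]) = phi(M2) - phi(M1).

   Vanishing part (in the spirit of Garland and Aharoni-Berger-Meshulam). Let x
   be a cochain on simplices of size k of the independence complex of a graph H
   on F. The off-diagonal terms of |d x|^2 + |d* x|^2 cancel except those
   coming from edges of H, and a bound Lam on the Laplacian of H gives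
     |d x|^2 + |d* x|^2 >= (#|F| - k Lam) |x|^2,
   so the homology vanishes if #|F| > k Lam. For the intersection graph of
   the edges of an r-uniform hypergraph of maximum degree D one can take
   Lam = r D, by bounding the Laplacian by the sum over the vertices of the
   Laplacians of the cliques of edges through them. *)

(** * Signs, boundary and coboundary on chains of subsets *)

Section Chains.
Set Implicit Arguments.
Unset Strict Implicit.
Unset Printing Implicit Defensive.
Import Order.TTheory GRing.Theory Num.Theory.
Local Open Scope ring_scope.

(* Only a tournament is needed, not an order, for the incidence signs to
   satisfy the simplicial identities. *)
Variables (R : realFieldType) (T : finType) (lt : rel T).
Hypothesis lt_irr : irreflexive lt.
Hypothesis lt_tour : forall u v, u != v -> lt v u = ~~ lt u v.

Local Notation chain := {ffun {set T} -> R^o}.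
Implicit Types (x y z : chain) (s t : {set T}).

Definition sgn (u : T) s : R := (-1) ^+ #|[set w in s | lt w u]|.

Lemma sgnU1 u v t : v \notin t -> sgn u (v |: t) = (-1) ^+ (lt v u) * sgn u t.
Proof.
move=> vt; rewrite /sgn -exprD; congr (_ ^+ _).
have -> : [set w in v |: t | lt w u] =
    if lt v u then v |: [set w in t | lt w u] else [set w in t | lt w u].
  apply/setP => w; case: ifP => vu; rewrite !inE; case: eqP => //= ->.
    by rewrite vu.
  by rewrite vu andbF.
by case: ifP => _; rewrite ?cardsU1 // inE (negPf vt).
Qed.

Lemma sgn_id u t : sgn u (u |: t) = sgn u t.
Proof.
rewrite /sgn; congr (_ ^+ _); apply: eq_card => w; rewrite !inE.
by case: (w =P u) => [->|]; rewrite ?lt_irr ?andbF.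
Qed.

Lemma sgnD1 u s : sgn u (s :\ u) = sgn u s.
Proof.
rewrite /sgn; congr (_ ^+ _); apply: eq_card => w; rewrite !inE.
by case: (w =P u) => [->|]; rewrite ?lt_irr ?andbF.
Qed.

Lemma sgn_swap u v t : u != v -> u \notin t -> v \notin t ->
  sgn u (v |: t) * sgn v t = - (sgn v (u |: t) * sgn u t).
Proof.
move=> uv ut vt; rewrite !sgnU1 // (lt_tour uv).
by case: (lt u v); rewrite /= ?expr1 ?expr0 ?mul1r ?mulN1r ?mulNr ?opprK mulrC.
Qed.

Lemma sgn_mul_swap u v t : u != v -> u \notin t -> v \notin t ->
  sgn u (v |: t) * sgn v (u |: t) = - (sgn u t * sgn v t).
Proof.
move=> uv ut vt; rewrite !sgnU1 // (lt_tour uv).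
by case: (lt u v); rewrite /= ?expr1 ?expr0 ?mul1r ?mulN1r ?mulNr ?mulrN.
Qed.

(** The other elements contribute equally to both signs, and exactly one of [lt u v] and [lt v u]
    holds. This will oppose the two rainbow facets of a matching. *)
Lemma sgn_opp u v s : u != v -> u \in s -> v \in s ->
  (forall w, w \in s -> w != u -> w != v -> lt w u = lt w v) ->
  sgn u s = - sgn v s.
Proof.
move=> uv us vs same.
have flag (x y : T) : x != y -> y \in s ->
    sgn x s = (-1) ^+ (lt y x) * sgn x (s :\ x :\ y).
  move=> xy ys; rewrite -(sgnD1 x) -{1}[s :\ x](@setD1K _ y) ?sgnU1 //.
    by rewrite !inE eqxx.
  by rewrite !inE eq_sym xy.
rewrite (flag u v) // (flag v u) 1?eq_sym // [s :\ v :\ u]setDDl setUC -setDDl.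
rewrite (lt_tour uv).
have -> : sgn u (s :\ u :\ v) = sgn v (s :\ u :\ v).
  rewrite /sgn; congr (_ ^+ _); apply: eq_card => w; rewrite !inE.
  case: eqVneq => //= wv; case: eqVneq => //= wu.
  by case: (boolP (w \in s)) => //= /same->.
by case: (lt u v); rewrite /= ?expr1 ?expr0 ?mul1r ?mulN1r ?opprK.
Qed.

(** Chains live on all subsets of [T], the empty set included, so homology is reduced; subcomplexes
    enter through [mask] and [supp]. Chains and cochains are identified by [dot], for which [bd] and
    [cb] are adjoint. *)
Definition bd x : chain :=
  [ffun t : {set T} => \sum_(u | u \notin t) sgn u t * x (u |: t)].
Definition cb x : chain :=
  [ffun s : {set T} => \sum_(u in s) sgn u s * x (s :\ u)].

Lemma sum_flags (F : T -> {set T} -> R) :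
  \sum_(t : {set T}) \sum_(u | u \notin t) F u t =
  \sum_(s : {set T}) \sum_(u in s) F u (s :\ u).
Proof.
rewrite (exchange_big_dep xpredT) //= [RHS](exchange_big_dep xpredT) //=.
apply: eq_bigr => u _.
rewrite (reindex_onto (fun s => s :\ u) (fun t => u |: t)) /=; last first.
  by move=> t ut; rewrite setU1K.
apply: eq_bigl => s; rewrite !inE eqxx /=.
apply/eqP/idP => [<-|us]; first by rewrite setU11.
by rewrite setD1K.
Qed.

Definition dot x y : R := \sum_s x s * y s.

Lemma dotC x y : dot x y = dot y x.
Proof. by apply: eq_bigr => s _; rewrite mulrC. Qed.

Lemma dot_eq0 x : dot x x = 0 -> x = 0.
Proof.
move=> /eqP; rewrite psumr_eq0 => [/allP xx0|s _]; last by rewrite -expr2 sqr_ge0.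
apply/ffunP => s; rewrite ffunE; apply/eqP.
by have := xx0 s (mem_index_enum _); rewrite mulf_eq0 orbb.
Qed.

Lemma dot_bd x y : dot (bd x) y = dot x (cb y).
Proof.
rewrite /dot; under eq_bigr do rewrite ffunE mulr_suml.
rewrite (sum_flags (fun u t => sgn u t * x (u |: t) * y t)).
apply: eq_bigr => s _; rewrite ffunE mulr_sumr; apply: eq_bigr => u us.
by rewrite sgnD1 setD1K // -!mulrA mulrCA.
Qed.

Lemma bd_is_linear : linear bd.
Proof.
move=> a x y; apply/ffunP => t; rewrite !ffunE scaler_sumr -big_split /=.
by apply: eq_bigr => u _; rewrite !ffunE mulrDr /GRing.scale /= mulrCA.
Qed.

Lemma cb_is_linear : linear cb.
Proof.
move=> a x y; apply/ffunP => t; rewrite !ffunE scaler_sumr -big_split /=.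
by apply: eq_bigr => u _; rewrite !ffunE mulrDr /GRing.scale /= mulrCA.
Qed.

HB.instance Definition _ := GRing.isLinear.Build R chain chain _ bd bd_is_linear.
HB.instance Definition _ := GRing.isLinear.Build R chain chain _ cb cb_is_linear.

(** Exchanging the two indices negates the sum, and 2 is invertible. *)
Lemma antisym_sum (P : pred T) (F : T -> T -> R) :
  (forall u v, P u -> P v -> u != v -> F u v = - F v u) ->
  \sum_(u | P u) \sum_(v | P v && (v != u)) F u v = 0.
Proof.
move=> antiF; set S := LHS.
suff: S = - S by move/eqP; rewrite -addr_eq0 -mulr2n mulrn_eq0 => /eqP.
rewrite {1}/S (exchange_big_dep P) /=; last by move=> i j _ /andP[].
rewrite -sumrN; apply: eq_bigr => u Pu; rewrite -sumrN.
rewrite big_mkcond [RHS]big_mkcond /=.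
apply: eq_bigr => v _; rewrite Pu /= [u == v]eq_sym; case: (P v) (antiF v u) => //=.
by case: eqP => //= _ -> .
Qed.

Lemma bd_bd x : bd (bd x) = 0.
Proof.
apply/ffunP => t; rewrite !ffunE.
rewrite -[RHS](antisym_sum (P := fun u => u \notin t)
  (F := fun u v => sgn v (u |: t) * sgn u t * x (v |: (u |: t)))); last first.
  by move=> u v ut vt uv; rewrite sgn_swap 1?eq_sym // mulNr setUCA.
apply: eq_bigr => u ut; rewrite ffunE mulr_sumr.
apply: eq_big => [v|v _]; first by rewrite !inE negb_or andbC.
by rewrite mulrA [sgn u t * _]mulrC.
Qed.

Lemma cb_cb x : cb (cb x) = 0.
Proof.
apply: dot_eq0; rewrite -!dot_bd bd_bd /dot big1 // => s _.
by rewrite ffunE mul0r.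
Qed.

Definition delta s : chain := [ffun t => (t == s)%:R].

Lemma dot_delta s x : dot x (delta s) = x s.
Proof.
rewrite /dot (bigD1 s) //= ffunE eqxx mulr1 big1 ?addr0 // => t /negPf ts.
by rewrite ffunE ts mulr0.
Qed.

Lemma bd_delta s : bd (delta s) = \sum_(u in s) sgn u s *: delta (s :\ u).
Proof.
apply/ffunP => t.
rewrite -dot_delta dot_bd dotC dot_delta ffunE sum_ffunE.
by apply: eq_bigr => u us; rewrite !ffunE eq_sym.
Qed.

Definition mask (P : pred {set T}) x : chain := [ffun s => if P s then x s else 0].

Lemma mask_is_linear P : linear (mask P).
Proof.
move=> a x y; apply/ffunP => t; rewrite !ffunE; case: ifP => // _.
by rewrite scaler0 addr0.
Qed.
HB.instance Definition _ P :=
  GRing.isLinear.Build R chain chain _ (mask P) (mask_is_linear P).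

Definition supp (P : pred {set T}) x := forall s, ~~ P s -> x s = 0.

Lemma mask_id P x : supp P x -> mask P x = x.
Proof. by move=> Px; apply/ffunP => s; rewrite ffunE; case: ifPn => // /Px. Qed.

Lemma supp_mask P x : supp P (mask P x).
Proof. by move=> s /negPf Ps; rewrite ffunE Ps. Qed.

Lemma dot_mask P x y : dot (mask P x) y = dot x (mask P y).
Proof.
by apply: eq_bigr => s _; rewrite !ffunE; case: ifP; rewrite ?mulr0 ?mul0r.
Qed.

(** * Vanishing of homology from the absence of harmonic chains *)

Section Acyclic.
Variables (X : pred {set T}) (k : nat).
Hypothesis Xsub : forall s t, t \subset s -> X s -> X t.
Let S s := X s && (#|s| == k).
Hypothesis harmonic0 : forall x, supp S x -> bd x = 0 ->
  mask X (cb x) = 0 -> x = 0.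

Lemma dotDl x y z : dot (x + y) z = dot x z + dot y z.
Proof. by rewrite -big_split; apply: eq_bigr => s _; rewrite ffunE mulrDl. Qed.

Lemma dot_ge0 x : 0 <= dot x x.
Proof. by apply: sumr_ge0 => s _; rewrite -expr2 sqr_ge0. Qed.

Lemma supp_bd_cb x : supp S x -> supp S (bd (mask X (cb x))).
Proof.
move=> Sx t St; rewrite ffunE big1 // => u ut; rewrite ffunE.
case: ifPn => [Xut|_]; last by rewrite mulr0.
rewrite ffunE big1 ?mulr0 // => v vut; rewrite [x _]Sx ?mulr0 //.
apply: contra St => /andP[_ /eqP ck]; rewrite /S (Xsub (subsetUr _ _) Xut) /=.
move: (cardsD1 v (u |: t)); rewrite vut ck cardsU1 ut.
by move=> /eqP; rewrite eqSS => /eqP->.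
Qed.

(** Hodge argument: the Laplacian on the span of [S] has trivial kernel, hence is onto, and
    [z = L y]. The part of [L y] coming from [cb (bd y)] is a cycle orthogonal to the cycles
    supported on [S], hence zero; the other part is a boundary. *)
Lemma cycle_is_boundary z : supp S z -> bd z = 0 ->
  exists2 w, supp (fun s => X s && (#|s| == k.+1)) w & bd w = z.
Proof.
move=> Sz bz0.
(* L is the Laplacian on the span of S and the identity on the complement. *)
pose L : {linear chain -> chain} :=
  ((bd \o mask X \o cb \o mask S) \+ (mask S \o cb \o bd \o mask S))
  \+ (idfun \- mask S).
have LE x : L x = bd (mask X (cb (mask S x)))
  + mask S (cb (bd (mask S x))) + (x - mask S x) by [].
have suppL x : (forall s, ~~ S s -> L x s = 0) -> supp S x.
  move=> Lx s Ss; have := Lx s Ss; rewrite LE !ffunE (negPf Ss) addr0 subr0.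
  have := supp_bd_cb (@supp_mask S x) Ss; rewrite ffunE => ->.
  by rewrite add0r.
have Linj : lker (linfun L) == 0%VS.
  apply/lker0P => x0 y0; rewrite !lfunE => /eqP; rewrite -subr_eq0 -(linearB L).
  set x := x0 - y0 => /eqP Lx0; apply/eqP; rewrite -subr_eq0 -/x; apply/eqP.
  have Sx : supp S x by apply: suppL => s _; rewrite Lx0 ffunE.
  move: Lx0; rewrite LE (mask_id Sx) subrr addr0 => Lx0.
  (* Adjointness turns this pairing into a sum of two squared norms. *)
  have: dot (bd (mask X (cb x)) + mask S (cb (bd x))) x = 0.
    by rewrite Lx0 /dot big1 // => s _; rewrite ffunE mul0r.
  have -> : dot (bd (mask X (cb x)) + mask S (cb (bd x))) x =
      dot (mask X (cb x)) (mask X (cb x)) + dot (bd x) (bd x).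
    rewrite dotDl dot_bd [dot (mask S _) _]dot_mask (mask_id Sx); congr (_ + _); last first.
      by rewrite dotC -dot_bd.
    by rewrite [RHS]dot_mask (mask_id (@supp_mask X _)) dotC.
  move=> /eqP; rewrite paddr_eq0 ?dot_ge0 // => /andP[/eqP h1 /eqP h2].
  by apply: harmonic0; rewrite ?(dot_eq0 h1) ?(dot_eq0 h2).
pose y := (linfun L)^-1%VF z.
have Ly : L y = z by rewrite -[LHS](lfunE L) lker0_lfunVK.
have Sy : supp S y by apply: suppL => s; rewrite Ly; apply: Sz.
move: Ly; rewrite LE (mask_id Sy) subrr addr0; set q := mask S _ => Ly.
exists (mask X (cb y)).
  move=> s; rewrite negb_and ffunE; case: ifP => //= Xs sk.
  rewrite ffunE big1 // => u us; rewrite Sy ?mulr0 // negb_and orbC.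
  by move: sk; rewrite (cardsD1 u s) us eqSS => ->.
suff q0 : q = 0 by rewrite -Ly q0 addr0.
apply: dot_eq0; rewrite {2}/q -dot_mask mask_id; last exact: supp_mask.
rewrite -dot_bd.
have -> : bd q = 0 by rewrite -[RHS]bz0 -Ly linearD /= bd_bd add0r.
by rewrite /dot big1 // => s _; rewrite ffunE mul0r.
Qed.
End Acyclic.

Lemma sum_flags2 (F : T -> T -> {set T} -> R) :
  \sum_(s : {set T}) \sum_(u in s) \sum_(v in s | v != u) F u v s =
  \sum_(t : {set T}) \sum_(u | u \notin t) \sum_(v | (v \notin t) && (v != u))
    F u v (u |: (v |: t)).
Proof.
rewrite (exchange_big_dep xpredT) //= [RHS](exchange_big_dep xpredT) //=.
apply: eq_bigr => u _.
rewrite (exchange_big_dep (fun v => v != u)) /=; last by move=> s v _ /andP[].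
rewrite [RHS](exchange_big_dep (fun v => v != u)) /=; last first.
  by move=> s v _ /andP[].
apply: eq_bigr => v vu.
rewrite (reindex_onto (fun t => u |: (v |: t)) (fun s => s :\ u :\ v)) /=.
  apply: eq_bigl => t; rewrite !inE !eqxx orbT vu /= !andbT.
  apply/eqP/andP => [<-|[ut vt]].
    by split; rewrite !inE !eqxx /= ?andbF.
  rewrite setU1K; last by rewrite !inE negb_or eq_sym vu.
  by rewrite setU1K.
move=> s /andP[us /andP[vs _]].
by rewrite [v |: _]setD1K ?setD1K // !inE vu.
Qed.

(** * Harmonic cochains on the independence complex of a graph *)

Section Flag.
Variables (H : rel T) (F : {set T}) (Lam : R) (k : nat).
Hypotheses (H_irr : irreflexive H) (H_sym : symmetric H).

Definition indep s :=
  (s \subset F) && [forall u in s, forall v in s, ~~ H u v].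
Definition deg u := #|[set v in F | H u v]|.

Lemma indepP s :
  reflect ({subset s <= F} /\ {in s &, forall u v, ~~ H u v}) (indep s).
Proof.
apply: (iffP andP) => [[/subsetP sF /forall_inP sH]|[sF sH]].
  by split=> // u v us vs; have /forall_inP := sH u us; apply.
split; first exact/subsetP.
by apply/forall_inP => u us; apply/forall_inP => v; apply: sH.
Qed.

Lemma indep_sub s t : t \subset s -> indep s -> indep t.
Proof.
move=> /subsetP ts /indepP[sF sH]; apply/indepP; split=> [u /ts/sF //|u v ut vt].
by apply: sH; apply: ts.
Qed.

Lemma indepU1 u t : indep (u |: t) =
  [&& u \in F, indep t & [forall v in t, ~~ H u v]].
Proof.
apply/indepP/and3P => [[sF sH]|[uF /indepP[tF tH] /forall_inP uH]].
  split; first by apply: sF; rewrite setU11.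
    apply/indepP; split=> [v vt|v w vt wt]; first by rewrite sF // setU1r.
    by rewrite sH // setU1r.
  by apply/forall_inP => v vt; rewrite sH ?setU11 ?setU1r.
split=> [v /setU1P[->|/tF] //|v w /setU1P[->|vt] /setU1P[->|wt]].
- by rewrite H_irr.
- exact: uH.
- by rewrite H_sym uH.
- exact: tH.
Qed.

(** An element of [F] lies in [s], is a neighbour of an element of [s], or extends [s]. *)
Lemma indep_count s : indep s ->
  (#|F| <= #|s| + \sum_(u in s) deg u + #|[set u | u \notin s & indep (u |: s)]|)%N.
Proof.
move=> Xs.
have: F \subset s :|: (\bigcup_(u in s) [set v in F | H u v])
    :|: [set u | u \notin s & indep (u |: s)].
  apply/subsetP => v vF; rewrite !inE; case: (boolP (v \in s)) => //= vs.
  rewrite indepU1 vF Xs /=; case: forall_inP => [_|nH]; first by rewrite orbT.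
  rewrite orbF; apply: contraT => vU; case: nH => u us.
  apply: contra vU => vu; apply/bigcupP; exists u => //.
  by rewrite inE vF H_sym.
move=> /subset_leq_card /leq_trans-> //.
rewrite (leq_trans (leq_card_setU _ _)) // leq_add2r.
rewrite (leq_trans (leq_card_setU _ _)) // leq_add2l.
elim/big_rec2: _ => [|u m A _ le_m]; first by rewrite cards0.
by rewrite (leq_trans (leq_card_setU _ _)) // leq_add2l.
Qed.

(* [spectral] bounds the Laplacian of H by Lam as a quadratic form. *)
Hypothesis spectral : forall y : T -> R, (forall u, u \notin F -> y u = 0) ->
  \sum_u ((deg u)%:R - Lam) * y u ^+ 2 <= \sum_u \sum_(v | H u v) y u * y v.
Hypothesis large : k%:R * Lam < #|F|%:R.

Lemma indep_harmonic0 x : supp (fun s => indep s && (#|s| == k)) x ->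
  bd x = 0 -> mask indep (cb x) = 0 -> x = 0.
Proof.
move=> Sx bx0 cx0.
(* [y t] is [x] read on the link of [t], with signs: its sum is [bd x t], and [spectral] will be
   applied to it. *)
pose y t u : R := if u \notin t then sgn u t * x (u |: t) else 0.
have x0 s : ~~ indep s -> x s = 0 by move=> Xs; rewrite Sx // (negPf Xs).
have y0 t u : ~~ indep (u |: t) -> y t u = 0.
  by move=> Xut; rewrite /y x0 // mulr0 if_same.
have y2 t u : y t u ^+ 2 = if u \notin t then x (u |: t) ^+ 2 else 0.
  by rewrite /y; case: ifP => _; rewrite ?expr0n // exprMn sqrr_sign mul1r.
have split_sqr (P : pred T) (f : T -> R) : (\sum_(u | P u) f u) ^+ 2 =
    \sum_(u | P u) f u ^+ 2
    + \sum_(u | P u) \sum_(v | P v && (v != u)) f u * f v.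
  rewrite expr2 mulr_suml -big_split /=; apply: eq_bigr => u us.
  by rewrite mulr_sumr (bigD1 u).
(* Expansion of the squared norm of [bd x]. *)
have A0 : \sum_(t : {set T}) \sum_u y t u ^+ 2
    + \sum_(t : {set T}) \sum_u \sum_(v | v != u) y t u * y t v = 0.
  rewrite -big_split big1 //= => t _; rewrite -(split_sqr xpredT) -big_mkcond /=.
  by move/ffunP: bx0 => /(_ t); rewrite !ffunE => ->; rewrite expr0n.
(* Expansion of the squared norm of [mask indep (cb x)], with [t] standing for [s :\ u :\ v] in the
   off-diagonal terms; [sgn_mul_swap] gives the minus sign. *)
have B0 : \sum_(t : {set T}) \sum_(u | u \notin t) (indep (u |: t))%:R * x t ^+ 2
    - \sum_(t : {set T}) \sum_u \sum_(v | v != u)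
        (indep (u |: (v |: t)))%:R * (y t u * y t v) = 0.
  transitivity (\sum_(s : {set T})
      ((indep s)%:R * (\sum_(u in s) sgn u s * x (s :\ u)) ^+ 2)); last first.
    apply: big1 => s _; move/ffunP: cx0 => /(_ s); rewrite !ffunE.
    by case: (indep s) => [->|_]; rewrite ?mul0r // expr0n mulr0.
  under [RHS]eq_bigr do rewrite split_sqr mulrDr.
  rewrite big_split /=; congr (_ + _).
    rewrite (sum_flags (fun u t => (indep (u |: t))%:R * x t ^+ 2)).
    apply: eq_bigr => s _; rewrite mulr_sumr; apply: eq_bigr => u us.
    by rewrite setD1K // exprMn sqrr_sign mul1r.
  under [RHS]eq_bigr do rewrite mulr_sumr.
  under [RHS]eq_bigr do under eq_bigr do rewrite mulr_sumr.
  rewrite (sum_flags2 (fun u v s => (indep s)%:R *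
    (sgn u s * x (s :\ u) * (sgn v s * x (s :\ v))))) -sumrN.
  apply: eq_bigr => t _; rewrite -sumrN [RHS]big_mkcond; apply: eq_bigr => u _.
  case: ifPn => [ut|/negPf ut]; last first.
    by rewrite big1 ?oppr0 // => v _; rewrite /y ut mul0r mulr0.
  rewrite -sumrN big_mkcond [RHS]big_mkcond; apply: eq_bigr => v _ /=.
  have [vt|/negPf vt] /= := boolP (v \notin t); last first.
    by rewrite /y vt !mulr0 oppr0 if_same.
  case: ifP => // vu; rewrite /y ut vt.
  rewrite setU1K; last by rewrite !inE negb_or eq_sym vu.
  rewrite sgn_id setUCA setU1K; last by rewrite !inE negb_or vu.
  rewrite sgn_id -mulrN; congr (_ * _); rewrite mulrACA -mulNr.
  by rewrite -sgn_mul_swap 1?eq_sym // [x _ * x _]mulrC mulrACA.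
(* If [u != v] both extend [t], then [u |: (v |: t)] is dependent exactly when [H u v]; otherwise
   [y t u * y t v] is zero. *)
have C0 : \sum_(t : {set T}) \sum_u \sum_(v | v != u) y t u * y t v
   - \sum_(t : {set T}) \sum_u \sum_(v | v != u)
       (indep (u |: (v |: t)))%:R * (y t u * y t v)
   = \sum_(t : {set T}) \sum_u \sum_(v | H u v) y t u * y t v.
  rewrite -sumrB; apply: eq_bigr => t _; rewrite -sumrB; apply: eq_bigr => u _.
  rewrite -sumrB big_mkcond [RHS]big_mkcond; apply: eq_bigr => v _ /=.
  have [->|vu] /= := eqVneq v u; first by rewrite H_irr.
  have [Xut|Xut] := boolP (indep (u |: t)); last first.
    by rewrite y0 // mul0r mulr0 subrr if_same.
  have [Xvt|Xvt] := boolP (indep (v |: t)); last first.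
    by rewrite [y t v]y0 // !mulr0 subrr if_same.
  rewrite indepU1 Xvt; move: Xut; rewrite indepU1 => /and3P[-> _ /forall_inP uH].
  have -> : [forall w in v |: t, ~~ H u w] = ~~ H u v.
    apply/forall_inP/idP => [|Huv w /setU1P[->|/uH] //].
    by apply; rewrite setU11.
  by case: (H u v); rewrite /= ?mul0r ?mul1r ?subr0 ?subrr.
have D0 : \sum_(t : {set T}) \sum_u ((deg u)%:R - Lam) * y t u ^+ 2
     <= \sum_(t : {set T}) \sum_u \sum_(v | H u v) y t u * y t v.
  apply: ler_sum => t _; apply: spectral => u uF; apply: y0; apply: contra uF.
  by rewrite indepU1 => /and3P[].
(* The coefficient of [x s ^+ 2] once [A0] to [D0] are combined, each [u in s] giving one flag
   [t = s :\ u]. For independent [s] of size [k], [indep_count] bounds it below by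
   [#|F| - k * Lam]. *)
pose c s := \sum_(u in s) (1 + ((deg u)%:R - Lam))
     + \sum_(u | u \notin s) (indep (u |: s))%:R.
have le0 : \sum_(s : {set T}) c s * x s ^+ 2 <= 0.
  have -> : \sum_(s : {set T}) c s * x s ^+ 2 = \sum_(t : {set T}) \sum_u y t u ^+ 2
      + \sum_(t : {set T}) \sum_u ((deg u)%:R - Lam) * y t u ^+ 2
      + \sum_(t : {set T}) \sum_(u | u \notin t) (indep (u |: t))%:R * x t ^+ 2.
    under eq_bigr do rewrite mulrDl.
    rewrite big_split; congr (_ + _); last first.
      by apply: eq_bigr => t _; rewrite mulr_suml.
    rewrite -big_split /=.
    transitivity (\sum_(t : {set T}) \sum_(u | u \notin t)
        (1 + ((deg u)%:R - Lam)) * x (u |: t) ^+ 2).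
      rewrite sum_flags; apply: eq_bigr => s _; rewrite mulr_suml.
      by apply: eq_bigr => u us; rewrite setD1K.
    apply: eq_bigr => t _; rewrite -big_split big_mkcond; apply: eq_bigr => u _ /=.
    by rewrite y2; case: ifP; rewrite ?mulr0 ?addr0 // mulrDl mul1r.
  lra.
have cS s : indep s && (#|s| == k) -> 0 < c s.
  case/andP=> /indep_count cnt /eqP sk.
  rewrite /c big_split sumrB !sumr_const sk -natr_sum /=.
  have -> : \sum_(u | u \notin s) (indep (u |: s))%:R =
      #|[set u | u \notin s & indep (u |: s)]|%:R :> R.
    rewrite -sum1_card natr_sum [LHS]big_mkcond [RHS]big_mkcond /=.
    by apply: eq_bigr => u _; rewrite inE; case: (u \notin s); case: indep.
  move: cnt large; rewrite sk -(ler_nat R) !natrD -mulr_natl; lra.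
apply/ffunP => s; rewrite ffunE; apply/eqP.
have ge0 t : 0 <= c t * x t ^+ 2.
  have [/cS/ltW ct|/Sx->] := boolP (indep t && (#|t| == k)).
    by rewrite mulr_ge0 // sqr_ge0.
  by rewrite expr0n mulr0.
have: \sum_(t : {set T}) c t * x t ^+ 2 == 0 by rewrite eq_le le0 sumr_ge0.
rewrite psumr_eq0 // => /allP/(_ s (mem_index_enum _)).
have [/cS/lt0r_neq0/negPf cs|/Sx->] := boolP (indep s && (#|s| == k)) => //.
by rewrite mulf_eq0 cs sqrf_eq0.
Qed.

Lemma indep_acyclic z : supp (fun s => indep s && (#|s| == k)) z -> bd z = 0 ->
  exists2 w, supp (fun s => indep s && (#|s| == k.+1)) w & bd w = z.
Proof. exact: cycle_is_boundary indep_sub indep_harmonic0 _. Qed.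
End Flag.
End Chains.

(** * Laplacian bound for the intersection graph of hypergraph edges *)

Section LineGraph.
Set Implicit Arguments.
Unset Strict Implicit.
Unset Printing Implicit Defensive.
Import Order.TTheory GRing.Theory Num.Theory.
Local Open Scope ring_scope.

(** Ordered pairs are summed, whence the factor 2. Loops of [K] are allowed and cancel on the right;
    the cliques used below have them. *)
Lemma sum_sqr_diff (R : realFieldType) (T : finType) (F : {set T}) (K : rel T)
    (y : T -> R) : symmetric K ->
  \sum_(u in F) \sum_(v in F | K u v) (y u - y v) ^+ 2 =
  2 * (\sum_(u in F) (deg K F u)%:R * y u ^+ 2
       - \sum_(u in F) \sum_(v in F | K u v) y u * y v).
Proof.
move=> Ksym.
have degE : \sum_(u in F) (deg K F u)%:R * y u ^+ 2 =
    \sum_(u in F) \sum_(v in F | K u v) y u ^+ 2.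
  apply: eq_bigr => u _; rewrite /deg -sum1_card natr_sum mulr_suml.
  by apply: eq_big => [v|v _]; rewrite ?inE ?mul1r.
have degE' : \sum_(u in F) (deg K F u)%:R * y u ^+ 2 =
    \sum_(u in F) \sum_(v in F | K u v) y v ^+ 2.
  rewrite degE (exchange_big_dep (mem F)) /=; last by move=> u v _ /andP[].
  by apply: eq_bigr => u uF; apply: eq_bigl => v; rewrite uF Ksym.
transitivity (\sum_(u in F) (deg K F u)%:R * y u ^+ 2
  + \sum_(u in F) (deg K F u)%:R * y u ^+ 2
  - 2 * \sum_(u in F) \sum_(v in F | K u v) y u * y v); last by lra.
rewrite {1}degE degE' mulr_sumr -big_split -sumrB /=; apply: eq_bigr => u _.
rewrite mulr_sumr -big_split -sumrB; apply: eq_bigr => v _ /=.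
by rewrite sqrrB; lra.
Qed.

Variable V : finType.
Implicit Types (E F M e f : {set V}).

Definition meets : rel {set V} := fun e f => (e != f) && ~~ [disjoint e & f].

Lemma meets_irr : irreflexive meets.
Proof. by move=> e; rewrite /meets eqxx. Qed.

Lemma meets_sym : symmetric meets.
Proof. by move=> e f; rewrite /meets eq_sym disjoint_sym. Qed.

Lemma matchingE (F M : {set {set V}}) : matching F M = indep meets F M.
Proof.
rewrite /matching /indep; congr (_ && _).
apply: eq_forallb_in => e _; apply: eq_forallb_in => f _.
by rewrite /meets; case: (e != f); rewrite /= ?negbK.
Qed.

(** Edges that meet share a vertex [p], so their squared differences are bounded by those over all
    pairs through a common [p]. At most [maxdeg E] edges pass through [p], and each edge has [r]
    vertices. *)
Lemma meets_spectral (R : realFieldType) (r : nat) (E F : {set {set V}})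
    (y : {set V} -> R) :
  uniform r E -> F \subset E -> (forall e, e \notin F -> y e = 0) ->
  \sum_e ((deg meets F e)%:R - (r * maxdeg E)%:R) * y e ^+ 2 <=
  \sum_e \sum_(f | meets e f) y e * y f.
Proof.
move=> /forall_inP Er /subsetP FE y0.
pose K p (e f : {set V}) := (p \in e) && (p \in f).
have Ksym p : symmetric (K p) by move=> e f; rewrite /K andbC.
have le_diff : \sum_(e in F) \sum_(f in F | meets e f) (y e - y f) ^+ 2 <=
    \sum_p \sum_(e in F) \sum_(f in F | K p e f) (y e - y f) ^+ 2.
  rewrite exchange_big /=; apply: ler_sum => e _.
  rewrite (exchange_big_dep (mem F)) /=; last by move=> ? ? _ /andP[].
  rewrite big_mkcondr /=; apply: ler_sum => f fF; rewrite fF /=.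
  case: ifP => [|_]; last by rewrite sumr_ge0 // => p _; rewrite sqr_ge0.
  rewrite /meets => /andP[_ /pred0Pn[p ef]].
  by rewrite (bigD1 p) //= lerDl sumr_ge0 // => q _; rewrite sqr_ge0.
have le_deg p : \sum_(e in F) \sum_(f in F | K p e f) (y e - y f) ^+ 2 <=
    2 * \sum_(e in F) (p \in e)%:R * ((maxdeg E)%:R * y e ^+ 2).
  rewrite sum_sqr_diff // ler_pM2l ?ltr0n // lerBlDr ler_wpDr //.
    have -> : \sum_(e in F) \sum_(f in F | K p e f) y e * y f =
        (\sum_(e in F | p \in e) y e) ^+ 2; last exact: sqr_ge0.
    rewrite expr2 mulr_suml [RHS]big_mkcondr; apply: eq_bigr => e eF /=.
    rewrite /K; case: (p \in e) => /=; first by rewrite mulr_sumr.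
    by rewrite big1 // => f; rewrite andbF.
  apply: ler_sum => e _; rewrite mulrA ler_wpM2r ?sqr_ge0 // /deg /K.
  case: (p \in e) => /=; last first.
    rewrite (_ : [set _ in _ | _] = set0) ?cards0 ?mul0r //.
    by apply/setP => f; rewrite !inE andbF.
  rewrite mul1r ler_nat (leq_trans _ (leq_bigmax p)) // subset_leq_card //.
  by apply/subsetP => f; rewrite !inE => /andP[/FE-> ->].
have le_all : \sum_(e in F) \sum_(f in F | meets e f) (y e - y f) ^+ 2 <=
    2 * \sum_(e in F) (r * maxdeg E)%:R * y e ^+ 2.
  apply: (le_trans le_diff); apply: (le_trans (ler_sum _ (fun p _ => le_deg p))).
  rewrite -[X in X <= _]mulr_sumr exchange_big ler_pM2l ?ltr0n //= ler_sum // => e eF.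
  rewrite -mulr_suml natrM -mulrA.
  suff -> : \sum_p (p \in e)%:R = r%:R :> R by [].
  rewrite -(eqP (Er e (FE e eF))) -sum1_card natr_sum [RHS]big_mkcond.
  by apply: eq_bigr => p _; case: (p \in e).
have -> : \sum_e \sum_(f | meets e f) y e * y f =
    \sum_(e in F) \sum_(f in F | meets e f) y e * y f.
  rewrite [RHS]big_mkcond; apply: eq_bigr => e _; case: ifPn => [_|/y0->].
    rewrite [RHS]big_mkcondl; apply: eq_bigr => f _; case: ifPn => // /y0->.
    by rewrite mulr0.
  by rewrite big1 // => f _; rewrite mul0r.
have -> : \sum_e ((deg meets F e)%:R - (r * maxdeg E)%:R) * y e ^+ 2 =
    \sum_(e in F) (deg meets F e)%:R * y e ^+ 2
    - \sum_(e in F) (r * maxdeg E)%:R * y e ^+ 2.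
  rewrite -sumrB [RHS]big_mkcond; apply: eq_bigr => e _; case: ifPn => [_|/y0->].
    by rewrite mulrBl.
  by rewrite expr0n mulr0.
have := le_all; rewrite (sum_sqr_diff _ _ meets_sym); lra.
Qed.

End LineGraph.

(** * Inductive construction of the chain-level prism *)

Section Fillings.
Set Implicit Arguments.
Unset Strict Implicit.
Unset Printing Implicit Defensive.
Import Order.TTheory GRing.Theory Num.Theory.
Local Open Scope ring_scope.

Variables (R : realFieldType) (T : finType) (lt : rel T) (n : nat).
Hypothesis lt_irr : irreflexive lt.
Local Notation chain := {ffun {set T} -> R^o}.
Implicit Types (I : {set 'I_n}) (i j : 'I_n) (s : {set T}).
Definition ord_lt : rel 'I_n := fun i j => (i < j)%N.

Lemma ord_lt_irr : irreflexive ord_lt.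
Proof. by move=> i; rewrite /ord_lt ltnn. Qed.

Lemma ord_lt_tour i j : i != j -> ord_lt j i = ~~ ord_lt i j.
Proof. by rewrite /ord_lt -val_eqE /=; case: ltngtP. Qed.

Variable X : {set 'I_n} -> pred {set T}.
Hypothesis XS : forall I i s, X (I :\ i) s -> X I s.
Hypothesis acyclic : forall I (z : chain), I != set0 ->
  supp (fun s => X I s && (#|s| == #|I|)) z -> bd lt z = 0 ->
  exists2 w : chain, supp (fun s => X I s && (#|s| == #|I|.+1)) w & bd lt w = z.

(** A rainbow simplex listed by colour. Being increasing gives the faces of [e @: I] the signs of
    the faces of [I], hence the same signs at both ends of the prism. *)
Definition monotone_section (e : 'I_n -> T) :=
  [/\ injective e, forall i j, lt (e i) (e j) = (i < j)%N
    & forall I, X I (e @: I)].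

Lemma sgn_section e i I : monotone_section e ->
  sgn R lt (e i) (e @: I) = sgn R ord_lt i I.
Proof.
case=> e_inj e_lt _; rewrite /sgn; congr (_ ^+ _).
rewrite -(card_imset _ e_inj); apply: eq_card => u; rewrite inE.
apply/andP/imsetP => [[/imsetP[j jI ->]]|[j]].
  by rewrite e_lt => ji; exists j; rewrite // inE jI.
by rewrite inE => /andP[jI ji] ->; rewrite imset_f // e_lt.
Qed.

Lemma imset_sectionD1 e i I : monotone_section e ->
  e @: (I :\ i) = (e @: I) :\ e i.
Proof.
case=> e_inj _ _; apply/setP => u; rewrite !inE.
apply/imsetP/andP => [[j]|[ui /imsetP[j jI uE]]].
  by rewrite !inE => /andP[ji jI] ->; rewrite imset_f // (inj_eq e_inj).
by exists j => //; rewrite !inE jI andbT; apply: contraNneq ui => <-; rewrite uE.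
Qed.

Lemma bd_section e I : monotone_section e ->
  bd lt (delta R (e @: I)) =
  \sum_(i in I) sgn R ord_lt i I *: delta R (e @: (I :\ i)).
Proof.
move=> se; have [e_inj _ _] := se.
rewrite bd_delta // big_imset /=; last by move=> i j _ _; apply: e_inj.
by apply: eq_bigr => i _; rewrite sgn_section // imset_sectionD1.
Qed.

Variables e0 e1 : 'I_n -> T.
Hypotheses (se0 : monotone_section e0) (se1 : monotone_section e1).

Definition prism_boundary (z : {set 'I_n} -> chain) I : chain :=
  delta R (e1 @: I) - delta R (e0 @: I)
  - \sum_(i in I) sgn R ord_lt i I *: z (I :\ i).

Definition fills (z : {set 'I_n} -> chain) I :=
  supp (fun s => X I s && (#|s| == #|I|.+1)) (z I)
  /\ bd lt (z I) = prism_boundary z I.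

(** Each [prism_boundary z I] is a cycle: the faces of its two end simplices cancel against the ends
    of the lower fillings, and double faces cancel in pairs. Acyclicity then fills it. *)
Lemma section_fillings k : exists z, forall I, (#|I| < k)%N -> fills z I.
Proof.
elim: k => [|k [z zP]]; first by exists (fun=> 0).
have zD1 I i : (#|I| <= k)%N -> i \in I -> fills z (I :\ i).
  by move=> Ik iI; apply: zP; rewrite (cardsD1 i I) iI in Ik.
(* The size bound sits under the existential, so that [w] can be chosen for all [I] at once, with
   default [0]. *)
have step I : exists w : chain, (#|I| <= k)%N ->
    supp (fun s => X I s && (#|s| == #|I|.+1)) w
    /\ bd lt w = prism_boundary z I.
  case: (leqP #|I| k) => Ik; last by exists 0.
  (* [acyclic] excludes the empty set; there both ends coincide and [0] fills. *)
  have [->|I0] := eqVneq I set0.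
    exists 0 => _; split; first by move=> s _; rewrite ffunE.
    by rewrite linear0 /prism_boundary !imset0 subrr big_set0 subrr.
  have supp_section e : monotone_section e ->
      supp (fun s => X I s && (#|s| == #|I|)) (delta R (e @: I)).
    case=> e_inj _ Xe s; rewrite ffunE; apply: contraNeq.
    have [-> _|_] := eqVneq s (e @: I); last by rewrite eqxx.
    by rewrite Xe card_imset /=.
  have bdz : bd lt (\sum_(i in I) sgn R ord_lt i I *: z (I :\ i)) =
      \sum_(i in I) sgn R ord_lt i I *:
        (delta R (e1 @: (I :\ i)) - delta R (e0 @: (I :\ i))).
    transitivity (\sum_(i in I) sgn R ord_lt i I *:
        (delta R (e1 @: (I :\ i)) - delta R (e0 @: (I :\ i)))
      - \sum_(i in I) sgn R ord_lt i I *: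
        \sum_(j in I :\ i) sgn R ord_lt j (I :\ i) *: z (I :\ i :\ j)).
      rewrite linear_sum -sumrB; apply: eq_bigr => i iI; rewrite linearZ -scalerBr.
      by have [_ /= ->] := zD1 I i Ik iI.
    rewrite -[RHS]subr0; congr (_ - _).
    (* At a fixed [s], the double sum is the double coboundary of the cochain [zs] on sets of
       indices. *)
    apply/ffunP => s; pose zs : {ffun {set 'I_n} -> R^o} := [ffun J => z J s].
    transitivity (cb ord_lt (cb ord_lt zs) I); last first.
      by rewrite (cb_cb ord_lt_irr ord_lt_tour) !ffunE.
    rewrite sum_ffunE ffunE.
    apply: eq_bigr => i _; rewrite !ffunE sum_ffunE; congr (_ * _).
    by apply: eq_bigr => j _; rewrite !ffunE.
  have bd0 : bd lt (prism_boundary z I) = 0.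
    rewrite /prism_boundary !linearB /= bdz !bd_section // -sumrB -sumrB big1 // => i _.
    by rewrite scalerBr subrr.
  have supp_bd : supp (fun s => X I s && (#|s| == #|I|)) (prism_boundary z I).
    move=> s nXs.
    have := supp_section _ se1 s nXs; have := supp_section _ se0 s nXs.
    rewrite !ffunE => -> ->; rewrite sum_ffunE subrr sub0r big1 ?oppr0 // => i iI.
    have [zX _] := zD1 I i Ik iI; rewrite ffunE zX ?scaler0 //.
    apply: contra nXs => /andP[/XS-> /eqP->] /=.
    by rewrite [in X in _ == X](cardsD1 i I) iI.
  by have [w wX wP] := acyclic I0 supp_bd bd0; exists w.
have [w wP] := fin_all_exists step.
(* Keeping the old fillings below size [k] leaves the boundary to be filled unchanged. *)
exists (fun I => if (#|I| < k)%N then z I else w I) => I; rewrite ltnS => Ik.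
have tE : prism_boundary (fun I => if (#|I| < k)%N then z I else w I) I =
    prism_boundary z I.
  rewrite /prism_boundary; congr (_ - _); apply: eq_bigr => i iI.
  by rewrite (cardsD1 i I) iI in Ik; rewrite Ik.
by rewrite /fills tE; case: ifP => [/zP //|_]; apply: wP.
Qed.
End Fillings.

(** * Colours, matchings and components of rainbow matchings *)

Section Rainbow.
Set Implicit Arguments.
Unset Strict Implicit.
Unset Printing Implicit Defensive.
Import Order.TTheory GRing.Theory Num.Theory.
Local Open Scope ring_scope.

Variables (V : finType) (r n : nat) (E : {set {set V}}).
Variable part : 'I_n -> {set {set V}}.
Hypothesis E_unif : uniform r E.
Hypothesis part_disj : forall i j, i != j -> [disjoint part i & part j].
Hypothesis part_cover : \bigcup_(i < n) part i = E.
Hypothesis part_large : forall i, (r * maxdeg E + 1 <= #|part i|)%N.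

Implicit Types (e f : {set V}) (M s : {set {set V}}) (I : {set 'I_n}) (i j : 'I_n).

Lemma part_inj e i j : e \in part i -> e \in part j -> i = j.
Proof.
move=> ei ej; apply/eqP; apply: contraT => /part_disj /pred0P/(_ e) /=.
by rewrite ei ej.
Qed.

(** The sum has a single term on an edge of [E], and gives the default 0 elsewhere. *)
Definition color e : nat := \sum_(i < n | e \in part i) i.

Lemma colorE e i : e \in part i -> color e = i.
Proof.
move=> ei; rewrite /color (big_pred1 i) // => j /=.
by apply/idP/eqP => [ej|->//]; apply: part_inj ej ei.
Qed.

(* Colours are compared first, so that the sign of a vertex in a rainbow
   simplex only depends on the colours. *)
Definition edge_lt : rel {set V} := fun e f =>
  (color e < color f)%N || (color e == color f) && (enum_rank e < enum_rank f)%N.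

Lemma edge_lt_irr : irreflexive edge_lt.
Proof. by move=> e; rewrite /edge_lt !ltnn eqxx. Qed.

Lemma edge_lt_tour e f : e != f -> edge_lt f e = ~~ edge_lt e f.
Proof.
rewrite -(inj_eq enum_rank_inj) -val_eqE /edge_lt /=.
by case: (ltngtP (color e) (color f)) => //=; case: ltngtP.
Qed.

Definition parts I := \bigcup_(i in I) part i.

Lemma partsT : parts setT = E.
Proof. by rewrite -part_cover; apply: eq_bigl => i; rewrite inE. Qed.

Lemma partsS I : parts I \subset E.
Proof.
by rewrite -part_cover; apply/bigcupsP => i _; apply: (bigcup_sup i).
Qed.

Lemma card_parts I : (#|I| * (r * maxdeg E + 1) <= #|parts I|)%N.
Proof.
pose p i := if i \in I then part i else set0.
have pE : parts I = \bigcup_i p i by rewrite /parts big_mkcond.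
rewrite -[leqRHS]sum1_card pE partition_disjoint_bigcup => [|i j ij]; last first.
  rewrite /p; case: ifP => _; last by rewrite -setI_eq0 set0I.
  by case: ifP => _; [exact: part_disj | rewrite -setI_eq0 setI0].
rewrite -sum_nat_const big_mkcond leq_sum // => i _.
by rewrite /p; case: ifP => // _; rewrite sum1_card.
Qed.

Definition matchings_of I := indep (@meets V) (parts I).

Lemma matchings_ofD1 I i s : matchings_of (I :\ i) s -> matchings_of I s.
Proof.
move=> /andP[sI sH]; apply/andP; split=> //; apply: (subset_trans sI).
by apply/bigcupsP => j; rewrite !inE => /andP[_ jI]; apply: bigcup_sup.
Qed.

Lemma matchings_acyclic (R : realFieldType) I (z : {ffun {set {set V}} -> R^o}) :
  I != set0 ->
  supp (fun s => matchings_of I s && (#|s| == #|I|)) z -> bd edge_lt z = 0 ->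
  exists2 w : {ffun {set {set V}} -> R^o},
    supp (fun s => matchings_of I s && (#|s| == #|I|.+1)) w & bd edge_lt w = z.
Proof.
rewrite -card_gt0 => I0.
apply: (indep_acyclic edge_lt_irr edge_lt_tour
  (Lam := (r * maxdeg E)%:R) (@meets_irr V) (@meets_sym V)).
  by move=> y y0; apply: meets_spectral => //; apply: partsS.
(* The [+ 1] in the size of each class makes this strict, [I] being nonempty. *)
rewrite -natrM ltr_nat (leq_trans _ (card_parts I)) //.
by rewrite mulnDr muln1 -addn1 leq_add2l.
Qed.

(** Let [e i] be the edge of [M] of colour [i]; it increases with [i] because [edge_lt] compares
    colours first. *)
Lemma rainbow_section M : full_rainbow E part M ->
  exists2 e, monotone_section edge_lt matchings_of e & e @: setT = M.
Proof.
case/andP=> Mm /forallP Mp.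
have /fin_all_exists[e eP] : forall i, exists e, M :&: part i = [set e].
  by move=> i; apply/cards1P.
have eM i : e i \in M /\ e i \in part i.
  by apply/andP; rewrite -in_setI eP set11.
have eC i : color (e i) = i by apply: colorE; case: (eM i).
exists e; last first.
  apply/setP => f; apply/imsetP/idP => [[i _ ->]|fM]; first by case: (eM i).
  have: f \in E by case/andP: Mm => /subsetP/(_ f fM).
  rewrite -part_cover => /bigcupP[i _ fi]; exists i => //.
  by apply/set1P; rewrite -eP inE fM.
have e_inj : injective e.
  by move=> i j eij; apply/val_inj; rewrite /= -eC eij eC.
split=> [//|i j|I].
  rewrite /edge_lt !eC; case: eqVneq => [ij|_]; last by rewrite orbF.
  by rewrite (val_inj ij) !ltnn.
apply/indepP; split=> [f /imsetP[i iI ->]|f g /imsetP[i iI ->] /imsetP[j jI ->]].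
  by apply/bigcupP; exists i => //; case: (eM i).
rewrite matchingE in Mm; have /indepP[_] := Mm; apply.
  by case: (eM i).
by case: (eM j).
Qed.

Definition reach (R : realFieldType) M : {ffun {set {set V}} -> R^o} :=
  [ffun s => (full_rainbow E part s && connect (RG_adj E part) M s)%:R].

(** [u] and [w] are the two edges of colour [i] in [s]: deleting either leaves one edge of each
    colour, and the two deletions have union [s]. *)
Lemma exchange_rainbow s u w i : matching E s -> #|s| = n.+1 -> u != w ->
  u \in s -> u \in part i -> full_rainbow E part (s :\ u) ->
  (s :\ u) :&: part i = [set w] ->
  full_rainbow E part (s :\ w) /\ RG_adj E part (s :\ u) (s :\ w).
Proof.
move=> ms sn uw us ui rbu swi.
have /setIP[] : w \in (s :\ u) :&: part i by rewrite swi set11.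
rewrite !inE => /andP[wu ws] wi.
have rbw : full_rainbow E part (s :\ w).
  case/andP: rbu => mu /forallP pu; apply/andP; split.
    rewrite !matchingE in ms *; apply: indep_sub ms; exact: subD1set.
  apply/forallP => j; have [->|ji] := eqVneq j i.
    apply/cards1P; exists u; apply/setP => f; rewrite !inE.
    apply/andP/eqP => [[/andP[fw fs] fi]|->]; last by rewrite uw us.
    by apply: contraNeq fw => fu; rewrite -in_set1 -swi !inE fu fs.
  rewrite -(eqP (pu j)); apply/eqP; apply: eq_card => f; rewrite !inE.
  have [fj|] := boolP (f \in part j); last by rewrite !andbF.
  have nf x : x \in part i -> (f == x) = false.
    move=> xi; apply: contraNF ji => /eqP fx.
    by rewrite (@part_inj f j i) ?fx // -fx.
  by rewrite (nf u) // (nf w).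
split=> //; rewrite /RG_adj rbu rbw.
have -> : (s :\ u) :|: (s :\ w) = s.
  apply/setP => f; rewrite !inE -andb_orl; case: eqVneq => //= ->.
  by rewrite uw.
by rewrite ms sn eqxx.
Qed.

Lemma reach_cocycle (R : realFieldType) M s : matching E s -> #|s| = n.+1 ->
  cb edge_lt (reach R M) s = 0.
Proof.
move=> ms sn; rewrite ffunE.
have [/forall_inP all0|] := boolP [forall u in s, reach R M (s :\ u) == 0].
  by apply: big1 => u us; rewrite (eqP (all0 u us)) mulr0.
rewrite negb_forall_in => /exists_inP[u us].
rewrite ffunE pnatr_eq0 eqb0 negbK => /andP[rbu cu].
have uE : u \in E by move: ms => /andP[/subsetP/(_ u us)].
move: uE; rewrite -part_cover => /bigcupP[i _ ui].
have /andP[_ /forallP/(_ i)/cards1P[w swi]] := rbu.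
have /setIP[] : w \in (s :\ u) :&: part i by rewrite swi set11.
rewrite !inE => /andP[wu ws] wi.
have uw : u != w by rewrite eq_sym.
have [rbw adj] := exchange_rainbow ms sn uw us ui rbu swi.
have cw : connect (RG_adj E part) M (s :\ w).
  exact: connect_trans cu (connect1 adj).
(* Only the facets opposite [u] and [w] are rainbow: deleting another [v] leaves two edges of colour
   [i]. *)
rewrite (bigD1 u) //= (bigD1 w) ?ws //= big1 ?addr0 => [|v /andP[/andP[vs vu] vw]].
  (* No third edge of [s] has colour [i], so every other edge compares equally with [u] and [w], and
     the signs are opposite. *)
  rewrite !ffunE rbu cu rbw cw (@sgn_opp _ _ _ edge_lt_irr edge_lt_tour u w) //.
    by rewrite mulNr addNr.
  move=> v vs vu vw; have : v \in E by move: ms => /andP[/subsetP/(_ v vs)].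
  rewrite -part_cover => /bigcupP[j _ vj].
  rewrite /edge_lt (colorE ui) (colorE wi) (colorE vj) val_eqE.
  suff /negPf-> : j != i by [].
  by apply: contraNneq vw => ji; rewrite -in_set1 -swi !inE vu vs -ji.
rewrite ffunE; case: (boolP (full_rainbow E part (s :\ v))) => [|_]; last first.
  by rewrite mulr0.
case/andP=> _ /forallP/(_ i)/cards1P[x svi].
have: u \in [set x] by rewrite -svi !inE eq_sym vu us.
have: w \in [set x] by rewrite -svi !inE eq_sym vw ws.
by move=> /set1P wx /set1P ux; rewrite ux wx eqxx in uw.
Qed.

Lemma rainbow_connected : RG_connected E part.
Proof.
move=> M1 M2 rb1 rb2.
have [e1 se1 e1M] := rainbow_section rb1.
have [e2 se2 e2M] := rainbow_section rb2.
(* The size bound is strict, so [n.+1] is what reaches [I = setT]. *)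
have [z zP] := section_fillings (R := rat) edge_lt_irr
  matchings_ofD1 (@matchings_acyclic rat) se1 se2 n.+1.
have zE I : fills edge_lt matchings_of e1 e2 z I.
  by apply: zP; rewrite ltnS (leq_trans (max_card _)) ?card_ord.
have [zT bdT] := zE setT.
pose phi := reach rat M1.
(* Adjointness moves the boundary onto [phi], whose coboundary vanishes on matchings of size
   [n.+1]. *)
have : dot phi (bd edge_lt (z setT)) = 0.
  rewrite dotC (dot_bd edge_lt_irr) /dot big1 // => s _.
  have [/andP[ms /eqP sn]|/zT->] :=
      boolP (matchings_of setT s && (#|s| == #|[set: 'I_n]|.+1)); last exact: mul0r.
  rewrite reach_cocycle ?mulr0 //; last by rewrite sn cardsT card_ord.
  by rewrite matchingE -partsT.
(* [z (setT :\ i)] lives on matchings without colour [i], and [phi] on matchings with every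
   colour. *)
have phi_z i s : phi s * z (setT :\ i) s = 0.
  have [zi _] := zE (setT :\ i).
  rewrite ffunE; case: (boolP (full_rainbow E part s)) => [|_]; last by rewrite mul0r.
  case/andP=> _ /forallP/(_ i)/cards1P[u sui].
  have /setIP[us ui] : u \in s :&: part i by rewrite sui set11.
  rewrite zi ?mulr0 // negb_and; apply/orP; left.
  apply/negP => /indepP[/(_ u us) /bigcupP[j]].
  by rewrite !inE => /andP[ji _] uj _; rewrite (part_inj uj ui) eqxx in ji.
have -> : dot phi (bd edge_lt (z setT)) =
    dot phi (delta rat M2) - dot phi (delta rat M1).
  rewrite bdT /prism_boundary e1M e2M /dot -sumrB; apply: eq_bigr => s _.
  move: (phi s) (phi_z^~ s) => a az.
  rewrite !ffunE sum_ffunE !mulrDr !mulrN mulr_sumr big1 ?subr0 // => i _.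
  by rewrite ffunE /GRing.scale /= mulrCA az mulr0.
(* What remains says that [phi] takes at [M2] its value 1 at [M1]. *)
rewrite !dot_delta !ffunE rb1 rb2 connect0 /=.
by case: connect.
Qed.
End Rainbow.

Theorem theorem6p6 (V : finType) (r n : nat) (E : {set {set V}})
    (part : 'I_n -> {set {set V}}) :
  uniform r E ->
  edge_partition E part ->
  (forall i, r * maxdeg E + 1 <= #|part i|) ->
  RG_connected E part.
Proof.
move=> E_unif [disj cover] large.
exact: rainbow_connected E_unif disj cover large.
Qed.
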